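(* Let $G$ be a finite group and let $H$ be a nontrivial proper subgroup of $G$. Then every nontrivial irreducible complex character of $H$ induces homogeneously to $G$ if and only if for every $x\in G\setminus H$ and every $h\in H$, the element $x$ is conjugate in $G$ to $xh$.
   Context: For a subgroup $H$ of a finite group $G$, a complex irreducible character $\theta\in\mathrm{Irr}(H)$ is said to induce homogeneously to $G$ if the induced character satisfies $\theta^G=a\xi$ for some $\xi\in\mathrm{Irr}(G)$ and some positive integer $a$. ''Nontrivial'' irreducible character means different from the trivial (principal) character $1_H$. The subgroup $H$ is not assumed to be normal in $G$. *)

(* Defs.v *)
From mathcomp Require Import all_boot all_order all_algebra.
From mathcomp Require Import all_fingroup all_solvable all_field all_character.

Set Implicit Arguments.
Unset Strict Implicit.
Unset Printing Implicit Defensive.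

Import GRing.Theory.
Local Open Scope ring_scope.

(* Characters are valued in algC: the complex irreducible characters of a     *)
(* finite group take algebraic values, and [irr] lists all of them.           *)
Definition induces_homogeneously (gT : finGroupType) (G H : {group gT})
    (theta : 'CF(H)) : Prop :=
  exists (xi : 'CF(G)) (a : nat),
    [/\ xi \in irr G, (0 < a)%N & 'Ind[G] theta = a%:R *: xi].

Arguments induces_homogeneously {gT} G {H} theta.

(* Main.v *)
Require Import Defs.
From mathcomp Require Import all_boot all_order all_algebra.
From mathcomp Require Import all_fingroup all_solvable all_field all_character.

(** For an irreducible character chi_i of G, let avg chi_i x be the mean of
    chi_i over the coset x H.  Both conditions of the theorem are equivalent to

      chi_i x = avg chi_i x   for every i and every x in G outside H.       (A)

    For the conjugacy condition: avg chi_i is constant on the cosets of H, so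
    (A) makes every irreducible character constant on each coset x H other than
    H itself, and irreducible characters separate conjugacy classes.

    For homogeneous induction, consider the sum over G of
    (chi_i - avg chi_i) * conj chi_j.  Generalized orthogonality gives its value
    [sum_defect_irr]: it is 0 if i <> j, and
    |G| (1 - m_i / chi_i(1)) if i = j, where m_i is the multiplicity of the
    principal character in Res chi_i.  Since avg chi_i is the constant m_i on H,
    the part of the sum over H is |H| times the sum over the nontrivial
    irreducible characters theta_k of H of a_ik a_jk, where
    a_ik = '[Res chi_i, theta_k] [sum_defect_subgroup].  Let O_ij be the
    remaining part, over G outside H.

    If (A) holds then O_ij = 0.  For i <> j a sum of nonnegative terms a_ik a_jk
    vanishes, so no nontrivial theta_k is a constituent of both Res chi_i and
    Res chi_j; by Frobenius reciprocity Ind theta_k has only one constituent.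

    Conversely, if every nontrivial theta_k induces homogeneously, then
    comparing degrees gives
    a_ik chi_i(1) = |G : H| theta_k(1) as soon as a_ik <> 0.  Substituting this
    for one of the factors in a_ik ^+ 2 shows that the part over H is already
    the whole of |G| (1 - m_i / chi_i(1)), so O_ii = 0.  But O_ii is the sum of
    |chi_i - avg chi_i| ^+ 2 outside H, because chi_i - avg chi_i is orthogonal
    to every function that is constant on the cosets of H [sum_defect_norm].
    Hence (A). *)

Set Implicit Arguments.
Unset Strict Implicit.
Unset Printing Implicit Defensive.

Import GRing.Theory Num.Theory.
Local Open Scope ring_scope.

(** * Averaging over the left cosets of a subgroup *)

Definition coset_avg (gT : finGroupType) (H : {group gT}) (phi : gT -> algC)
    (x : gT) : algC :=
  #|H|%:R^-1 * \sum_(h in H) phi (x * h)%g.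

Definition coset_defect (gT : finGroupType) (H : {group gT})
    (phi : gT -> algC) (x : gT) : algC :=
  phi x - coset_avg H phi x.

Lemma coset_avgM (gT : finGroupType) (H : {group gT}) (phi : gT -> algC) x h :
  h \in H -> coset_avg H phi (x * h)%g = coset_avg H phi x.
Proof.
move=> Hh; rewrite /coset_avg; congr (_ * _).
rewrite [RHS](reindex_inj (mulgI h)) /=.
by apply: eq_big => [k | k _]; rewrite ?groupMl // mulgA.
Qed.

Lemma coset_avg_const (gT : finGroupType) (H : {group gT}) (phi : gT -> algC)
    x (c : algC) :
  (forall h, h \in H -> phi (x * h)%g = c) -> coset_avg H phi x = c.
Proof.
move=> phi_c; rewrite /coset_avg (eq_bigr (fun=> c)) //.
by rewrite sumr_const -[c *+ _]mulr_natl mulKf // neq0CG.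
Qed.

Lemma coset_avg_subgroup (gT : finGroupType) (G H : {group gT})
    (phi : 'CF(G)) x :
  H \subset G -> x \in H -> coset_avg H phi x = '['Res[H] phi, 1].
Proof.
move=> sHG Hx; rewrite -(mul1g x) coset_avgM // /coset_avg cfdotE.
congr (_ * _); apply: eq_bigr => h Hh.
by rewrite mul1g cfResE // cfun1E Hh rmorph1 mulr1.
Qed.

Lemma mulg_setD_subgroup (gT : finGroupType) (G H : {group gT}) x h :
  H \subset G -> h \in H -> ((x * h)%g \in G :\: H) = (x \in G :\: H).
Proof. by move=> sHG Hh; rewrite !inE !groupMr // (subsetP sHG). Qed.

(** Averaging is a self-adjoint projection, whose image consists of the
    functions that are constant on cosets; this is the resulting orthogonality
    on the union of the cosets other than H. *)
Lemma sum_defect_invariant (gT : finGroupType) (G H : {group gT})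
    (phi g : gT -> algC) :
    H \subset G -> (forall x h, h \in H -> g (x * h)%g = g x) ->
  \sum_(x in G :\: H) coset_defect H phi x * g x = 0.
Proof.
move=> sHG gH; pose S := \sum_(x in G :\: H) phi x * g x.
under eq_bigr do rewrite mulrBl.
rewrite sumrB; apply/eqP; rewrite subr_eq0; apply/eqP; rewrite -/S.
under eq_bigr do rewrite -mulrA mulr_suml.
rewrite -mulr_sumr exchange_big /= (eq_bigr (fun=> S)) => [|h Hh].
  by rewrite sumr_const -[S *+ _]mulr_natl mulKf // neq0CG.
rewrite /S [RHS](reindex_inj (mulIg h)) /=.
by apply: eq_big => [x | x _]; rewrite ?mulg_setD_subgroup ?gH.
Qed.

Lemma sum_defect_norm (gT : finGroupType) (G H : {group gT})
    (phi : gT -> algC) : H \subset G ->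
  \sum_(x in G :\: H) coset_defect H phi x * (phi x)^*
    = \sum_(x in G :\: H) `|coset_defect H phi x| ^+ 2.
Proof.
move=> sHG; apply/eqP; rewrite -subr_eq0 -sumrB.
rewrite -[X in _ == X](sum_defect_invariant phi
  (g := fun x => (coset_avg H phi x)^*) sHG).
  apply/eqP/eq_bigr=> x _; rewrite normCK -mulrBr -rmorphB /=.
  by rewrite /coset_defect subKr.
by move=> x h Hh; rewrite coset_avgM.
Qed.

(** * The conjugacy condition in terms of averages *)

(** The reverse implication rests on the second orthogonality relation: if all
    irreducible characters agree at x and x h, their scalar product over the
    irreducible characters is #|'C_G[x]|, which is nonzero. *)
Lemma conj_coset_iff_defect0 (gT : finGroupType) (G H : {group gT}) :
    H \subset G ->
  (forall x h : gT, x \in G :\: H -> h \in H -> (x * h \in x ^: G)%g)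
  <-> (forall (i : Iirr G) x, x \in G :\: H -> coset_defect H 'chi_i x = 0).
Proof.
move=> sHG; split=> [conjH i x GHx | avgH x h GHx Hh].
  apply/eqP; rewrite subr_eq0 eq_sym; apply/eqP/coset_avg_const => h Hh.
  by case/imsetP: (conjH x h GHx Hh) => y Gy ->; rewrite cfunJ.
have chi_xh (i : Iirr G): 'chi_i (x * h)%g = 'chi_i x.
  have /eqP := avgH i x GHx; rewrite subr_eq0 => /eqP->.
  rewrite -(coset_avgM _ x Hh); apply/eqP; rewrite -subr_eq0; apply/eqP.
  by apply: avgH; rewrite mulg_setD_subgroup.
have [Gx _] := setDP GHx.
have := second_orthogonality_relation (x * h)%g Gx.
under eq_bigr do rewrite chi_xh.
rewrite second_orthogonality_relation // class_refl mulr1n.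
by case: (_ \in _) => // /eqP; rewrite mulr0n (negPf (neq0CG _)).
Qed.

(** * The defects of the irreducible characters *)

(** The average over h of the generalized orthogonality relations for the
    translates of chi_i by h, subtracted from the relation for h = 1. *)
Lemma sum_defect_irr (gT : finGroupType) (G H : {group gT}) (i j : Iirr G) :
    H \subset G ->
  \sum_(x in G) coset_defect H 'chi_i x * ('chi_j x)^*
    = (i == j)%:R * (#|G|%:R * (1 - '['Res[H] 'chi_i, 1] / 'chi_i 1%g)).
Proof.
move=> sHG.
have gor y : \sum_(x in G) 'chi_i (x * y)%g * ('chi_j x)^*
             = (i == j)%:R * (#|G|%:R * ('chi_i y / 'chi_i 1%g)).
  rewrite mulrCA -generalized_orthogonality_relation mulVKf ?neq0CG //.
  by apply: eq_bigr => x _; rewrite irr_inv.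
under eq_bigr do rewrite mulrBl.
rewrite sumrB.
have ->: \sum_(x in G) 'chi_i x * ('chi_j x)^* = (i == j)%:R * #|G|%:R.
  rewrite -[RHS]mulr1 -[X in _ * X](divff (irr1_neq0 i)) -mulrA -gor.
  by apply: eq_bigr => x _; rewrite mulg1.
under eq_bigr do rewrite -mulrA mulr_suml.
rewrite -mulr_sumr exchange_big /=; under eq_bigr do rewrite gor.
rewrite -!mulr_sumr -mulr_suml [in RHS]mulrBr mulr1 [in RHS]mulrBr.
congr (_ - _); rewrite mulrCA; congr (_ * _); rewrite mulrCA mulrA.
rewrite -(coset_avg_subgroup _ sHG (group1 H)) /coset_avg !mulrA.
by under [in RHS]eq_bigr do rewrite mul1g.
Qed.

(** On H the defect of chi_i is Res chi_i without its principal component, so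
    the sum is a scalar product of class functions of H. *)
Lemma sum_defect_subgroup (gT : finGroupType) (G H : {group gT})
    (i j : Iirr G) : H \subset G ->
  \sum_(x in H) coset_defect H 'chi_i x * ('chi_j x)^*
    = #|H|%:R * \sum_(k : Iirr H | k != 0)
        '['Res[H] 'chi_i, 'chi_k] * '['Res[H] 'chi_j, 'chi_k].
Proof.
move=> sHG; set m := '['Res[H] 'chi_i, 1].
have real_m (k : Iirr H) : '['Res[H] 'chi_j, 'chi_k]^*
                           = '['Res[H] 'chi_j, 'chi_k].
  by rewrite conj_natr // Cnat_cfdot_char_irr ?cfRes_char ?irr_char.
transitivity (#|H|%:R * '['Res[H] 'chi_i - m *: 1, 'Res[H] 'chi_j]).
  rewrite cfdotE mulVKf ?neq0CG //; apply: eq_bigr => x Hx.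
  rewrite !cfunE !cfResE // cfun1E Hx mulr1 /coset_defect.
  by rewrite (coset_avg_subgroup _ sHG Hx).
congr (_ * _); rewrite cfdot_sum_irr (bigD1 0) //=.
rewrite cfdotBl cfdotZl irr0 cfnorm1 mulr1 subrr mul0r add0r.
apply: eq_bigr => k nz_k; rewrite real_m cfdotBl cfdotZl -irr0 cfdot_irr.
by rewrite eq_sym (negPf nz_k) mulr0 subr0.
Qed.

Lemma sum_defect_split (gT : finGroupType) (G H : {group gT})
    (i j : Iirr G) : H \subset G ->
  \sum_(x in G :\: H) coset_defect H 'chi_i x * ('chi_j x)^*
    = (i == j)%:R * (#|G|%:R * (1 - '['Res[H] 'chi_i, 1] / 'chi_i 1%g))
      - #|H|%:R * \sum_(k : Iirr H | k != 0)
          '['Res[H] 'chi_i, 'chi_k] * '['Res[H] 'chi_j, 'chi_k].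
Proof.
move=> sHG; rewrite -sum_defect_irr // -sum_defect_subgroup //.
by rewrite [in RHS](big_setID H) /= (setIidPr sHG) [RHS]addrC addKr.
Qed.

(** * Homogeneous induction in terms of averages *)

Lemma defect0_homogeneous (gT : finGroupType) (G H : {group gT})
    (k : Iirr H) : H \subset G -> k != 0 ->
    (forall (i : Iirr G) x, x \in G :\: H -> coset_defect H 'chi_i x = 0) ->
  induces_homogeneously G 'chi_k.
Proof.
move=> sHG nz_k avgH; pose a i := '['Res[H] 'chi[G]_i, 'chi_k].
have nat_a (i : Iirr G) (l : Iirr H) :
    '['Res[H] 'chi_i, 'chi_l] \is a Num.nat.
  by rewrite Cnat_cfdot_char_irr ?cfRes_char ?irr_char.
have aE i : '['Ind[G] 'chi_k, 'chi_i] = a i.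
  by rewrite cfdotC -cfdot_Res_l conj_natr.
have a_disjoint i j : i != j -> a i * a j = 0.
  move=> ij; have /eqP := sum_defect_split i j sHG.
  rewrite (negPf ij) mul0r add0r big1 => [|x GHx]; last first.
    by rewrite avgH ?mul0r.
  rewrite eq_sym oppr_eq0 mulf_eq0 (negPf (neq0CG H)) /= => /eqP sum0.
  apply: (psumr_eq0P _ sum0) => // l _.
  by rewrite mulr_ge0 // natr_ge0.
have [i nz_ai] : exists i, a i != 0.
  have: 'Ind[G] 'chi_k != 0 by rewrite Ind_irr_neq0.
  case/neq0_has_constt=> i; rewrite irr_consttE aE => nz; by exists i.
have /natrP[n an] := nat_a i k.
exists 'chi_i, n; split; first exact: mem_irr.
  by move: nz_ai; rewrite /a an pnatr_eq0 lt0n.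
rewrite -an [LHS]cfun_sum_cfdot (bigD1 i) //= aE big1 ?addr0 // => j ji.
have /eqP := a_disjoint _ _ ji.
by rewrite mulf_eq0 (negPf nz_ai) orbF aE => /eqP->; rewrite scale0r.
Qed.

(** If chi_i is the only constituent of Ind theta_k, its multiplicity is the
    ratio of the degrees of Ind theta_k and chi_i. The further factor of the
    multiplicity on both sides covers the case where it is 0. *)
Lemma homogeneous_multiplicity (gT : finGroupType) (G H : {group gT})
    (i : Iirr G) (k : Iirr H) :
    H \subset G -> induces_homogeneously G 'chi_k ->
  '['Res[H] 'chi_i, 'chi_k] ^+ 2
    = '['Res[H] 'chi_i, 'chi_k] * 'chi_k 1%g * (#|G : H|%g%:R / 'chi_i 1%g).
Proof.
move=> sHG [xi [a [/irrP[j ->] _ IndE]]].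
have := cfInd1 'chi_k sHG; rewrite IndE cfunE => deg.
rewrite cfdot_Res_l IndE cfdotZr cfdot_irr conj_natr ?rpred_nat //.
case: eqP => [-> | _]; last by rewrite mulr0 expr0n !mul0r.
rewrite mulr1 expr2 -mulrA; congr (_ * _).
by rewrite mulrA ['chi_k _ * _]mulrC -deg mulfK ?irr1_neq0.
Qed.

Lemma homogeneous_defect0 (gT : finGroupType) (G H : {group gT}) :
    H \subset G ->
    (forall k : Iirr H, k != 0 -> induces_homogeneously G 'chi_k) ->
  forall (i : Iirr G) x, x \in G :\: H -> coset_defect H 'chi_i x = 0.
Proof.
move=> sHG homH i; set m := '['Res[H] 'chi_i, 1].
have sum_nontriv :
    \sum_(k : Iirr H | k != 0) '['Res[H] 'chi_i, 'chi_k] * 'chi_k 1%g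
    = 'chi_i 1%g - m.
  rewrite -(cfRes1 H 'chi_i).
  rewrite [in RHS](cfun_sum_cfdot ('Res[H] 'chi_i)) sum_cfunE.
  rewrite [in RHS](bigD1 0) //= cfunE irr0 cfun11 mulr1 addrC addrK.
  by apply: eq_bigr => k _; rewrite cfunE.
have norm0 : \sum_(x in G :\: H) `|coset_defect H 'chi_i x| ^+ 2 = 0.
  rewrite -sum_defect_norm // sum_defect_split // eqxx mul1r -/m.
  rewrite [X in _ - _ * X](_ : _ = ('chi_i 1%g - m)
                                   * (#|G : H|%g%:R / 'chi_i 1%g)).
    apply/eqP; rewrite subr_eq0 -(Lagrange sHG) natrM -mulrA.
    by rewrite [X in _ == _ * X]mulrCA mulrBl divff ?irr1_neq0.
  rewrite -sum_nontriv mulr_suml; apply: eq_bigr => k nz_k.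
  by rewrite -expr2; apply: homogeneous_multiplicity; last exact: homH.
move=> x GHx; apply/eqP; rewrite -normr_eq0 -sqrf_eq0; apply/eqP.
by apply: (psumr_eq0P _ norm0) => // y _; rewrite exprn_ge0.
Qed.

Theorem theorem1 (gT : finGroupType) (G H : {group gT})
    (Hnontrivial : H :!=: 1%g) (Hproper : H \proper G) :
  (forall theta : 'CF(H), theta \in irr H -> theta != 1 ->
     induces_homogeneously G theta)
  <->
  (forall x h : gT, x \in G :\: H -> h \in H -> (x * h \in x ^: G)%g).
Proof.
have sHG := proper_sub Hproper.
split=> [homH | /(conj_coset_iff_defect0 sHG) avgH theta /irrP[k ->]].
  apply/conj_coset_iff_defect0/homogeneous_defect0 => // k nz_k.
  by apply: homH; rewrite ?mem_irr // irr_eq1.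
by rewrite irr_eq1 => nz_k; apply: defect0_homogeneous.
Qed.
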